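(* Let $\pi\colon\mathbb{R}_+\times X\to X$ be a $C^0$-semiflow on a Polish space $X$ such that (a) it is topologically transitive and $\mathrm{Int}_X(\mathbb{R}_+x_0)=\emptyset$ for some point $x_0\in X$ with dense orbit $\mathbb{R}_+x_0$; (b) there exists a periodic point $p$ in $X$. Then the semiflow is multi-dimensional Li-Yorke chaotic. In particular, if a $C^0$-semiflow $\pi\colon\mathbb{R}_+\times X\to X$ on a Polish space $X$ is Devaney chaotic, then it is multi-dimensional Li-Yorke chaotic.
   Context: Let $T=(\mathbb{R}_+,+)$, $\mathbb{R}_+=[0,\infty)$, with the usual topology. A $C^0$-semiflow is a jointly continuous map $\pi\colon T\times X\to X$, $(t,x)\mapsto tx:=\pi(t,x)$, with $\pi(s,\pi(t,x))=\pi(s+t,x)$ and $\pi(0,x)=x$. $T$ acts on $X^k$ by $t(x_1,\dots,x_k)=(tx_1,\dots,tx_k)$. $Tx=\{tx : t\in T\}$, $t^{-1}V=\{x : tx\in V\}$, and $\mathrm{Int}_X A$ is the interior of $A$ in $X$. A subset $B\subseteq T$ is syndetic if there is a compact $K\subseteq T$ with $(K+t)\cap B\neq\emptyset$ for all $t\in T$. A point $x$ is periodic if $\{t\in T : tx=x\}$ is syndetic in $T$. The semiflow is topologically transitive if for all nonempty open $U,V\subseteq X$ there is $t\in T$ with $U\cap t^{-1}V\neq\emptyset$; it is minimal if $\overline{Tx}=X$ for every $x\in X$. It is Devaney chaotic if (1) it is topologically transitive, (2) its periodic points are dense in $X$, and (3) it is not minimal. The semiflow is multi-dimensional Li-Yorke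 chaotic if for every increasing sequence $\{F_n\}_{n\ge1}$ of compact subsets of $T$ there is an uncountable set $\Theta\subseteq X$ such that for any $k\ge2$ and any distinct $x_1,\dots,x_k\in\Theta$ there are sequences $\{s_n\},\{t_n\}$ in $T$ and a point $q\in X$ with $s_n\notin F_n$ for all $n$, $s_n(x_1,\dots,x_k)\to(x_1,\dots,x_k)$ and $t_n(x_1,\dots,x_k)\to(q,\dots,q)$ as $n\to\infty$. *)

(* Defs.v *)
From HB Require Import structures.
From mathcomp Require Import all_boot all_order all_algebra.
From mathcomp Require Import all_classical all_reals all_analysis.

Set Implicit Arguments.
Unset Strict Implicit.
Unset Printing Implicit Defensive.

Import Order.TTheory GRing.Theory Num.Theory.
Import numFieldNormedType.Exports.

Local Open Scope classical_set_scope.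
Local Open Scope ring_scope.

Definition separable_space (X : topologicalType) : Prop :=
  exists2 D : set X, countable D & dense D.

(* A metric is given here as a plain function, so that Polishness is a property
   of the topology of [X] alone. *)
Definition is_metric (R : realType) (X : Type) (d : X -> X -> R) : Prop :=
  [/\ forall x y, 0 <= d x y,
      forall x y, d x y = 0 <-> x = y,
      forall x y, d x y = d y x
    & forall x y z, d x z <= d x y + d y z].

Definition metric_induces_topology (R : realType) (X : topologicalType)
    (d : X -> X -> R) : Prop :=
  forall (x : X) (A : set X),
    nbhs x A <-> exists2 e : R, 0 < e & [set y | d x y < e] `<=` A.

Definition metric_complete (R : realType) (X : topologicalType)
    (d : X -> X -> R) : Prop :=
  forall u : nat -> X,
    (forall e : R, 0 < e -> exists N : nat, forall m n : nat,
        (N <= m)%N -> (N <= n)%N -> d (u m) (u n) < e) ->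
    exists l : X, u @ \oo --> l.

Definition polish_space (R : realType) (X : topologicalType) : Prop :=
  separable_space X /\
  exists d : X -> X -> R,
    [/\ is_metric d, metric_induces_topology d & metric_complete d].

(* The acting semigroup [T = [0, +oo[], as a subset of [R].  A semiflow is
   represented by a function on [R * X] whose values at negative times are
   never used: every condition below is restricted to [Rplus]. *)
Definition Rplus (R : realType) : set R := [set t | 0 <= t].
Arguments Rplus : clear implicits.

Definition semiflow (R : realType) (X : topologicalType) (phi : R -> X -> X) :
    Prop :=
  [/\ {within Rplus R `*` [set: X],
         continuous (fun z : R * X => phi z.1 z.2)},
      forall s t x, Rplus R s -> Rplus R t -> phi s (phi t x) = phi (s + t) x
    & forall x, phi 0 x = x].

Definition semi_orbit (R : realType) (X : topologicalType) (phi : R -> X -> X)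
    (x : X) : set X :=
  [set phi t x | t in Rplus R].

Definition syndetic (R : realType) (B : set R) : Prop :=
  exists K : set R, [/\ K `<=` Rplus R, compact K &
    forall t, Rplus R t -> [set k + t | k in K] `&` B !=set0].

Definition periodic_point (R : realType) (X : topologicalType) (phi : R -> X -> X)
    (x : X) : Prop :=
  syndetic [set t | Rplus R t /\ phi t x = x].

Definition topologically_transitive (R : realType) (X : topologicalType)
    (phi : R -> X -> X) : Prop :=
  forall U V : set X, open U -> open V -> U !=set0 -> V !=set0 ->
    exists2 t, Rplus R t & U `&` (phi t @^-1` V) !=set0.

Definition minimal_semiflow (R : realType) (X : topologicalType) (phi : R -> X -> X) :
    Prop :=
  forall x, closure (semi_orbit phi x) = [set: X].

Definition devaney_chaotic (R : realType) (X : topologicalType)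
    (phi : R -> X -> X) : Prop :=
  [/\ topologically_transitive phi, dense [set x | periodic_point phi x]
    & ~ minimal_semiflow phi].

(* [X ^ k] is [{ptws 'I_k -> X}], the k-fold product with the product
   topology. *)
Definition diag_act (R : realType) (X : topologicalType) (phi : R -> X -> X)
    (k : nat) (t : R) (x : {ptws 'I_k -> X}) : {ptws 'I_k -> X} :=
  fun i => phi t (x i).

(* "Increasing" is read as [F n `<=` F n.+1]. *)
Definition multidim_li_yorke_chaotic (R : realType) (X : topologicalType)
    (phi : R -> X -> X) : Prop :=
  forall F : nat -> set R,
    (forall n, F n `<=` Rplus R) -> (forall n, compact (F n)) ->
    (forall n, F n `<=` F n.+1) ->
    exists Theta : set X, ~ countable Theta /\
      forall (k : nat) (x : {ptws 'I_k -> X}), (2 <= k)%N ->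
        injective x -> (forall i, Theta (x i)) ->
        exists (s t : nat -> R) (q : X),
          [/\ forall n, Rplus R (s n) /\ Rplus R (t n),
              forall n, ~ F n (s n),
              (fun n => diag_act phi (s n) x) @ \oo --> x
            & (fun n => diag_act phi (t n) x) @ \oo -->
                ((fun=> q) : {ptws 'I_k -> X})].

(* Main.v *)
Require Import Defs.
From mathcomp Require Import all_boot all_order all_algebra.
From mathcomp Require Import all_classical all_reals all_analysis.
From mathcomp Require Import lra zify.
Import Order.TTheory GRing.Theory Num.Theory.
Import numFieldNormedType.Exports.
Local Open Scope classical_set_scope.
Local Open Scope ring_scope.

Set Implicit Arguments.
Unset Strict Implicit.

(** Let [tau] be a period of the periodic point and [f = phi tau].  Everything
    happens along the [f]-orbit of one point [y]: it suffices that [y] has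
    pairwise distinct [f]-iterates, that it is [f]-recurrent, and that its
    [f]-orbit accumulates at some fixed point [q] of [f].  Indeed, if
    [iter m f y] is close to [y] then, by continuity, [iter m f] moves only
    slightly any given finite set of iterates of [y]; if [iter m f y] is close
    to [q] then, as [f q = q], [iter m f] brings any given finite set of iterates
    close to [q].  Both properties pass to small balls around these iterates.  So
    one can choose rapidly increasing exponents [m i] such that, for every 0-1
    sequence [a], the points with exponents [\sum_(i < n) a i * m i] converge to
    a point [z a], in such a way that the same times return all the [z a] to
    themselves and the same times push all of them to [q].  The range of [z] is a
    scrambled set that serves all tuples at once
    ([scrambled_cantor_set]).

    To find [y] and [q], start from a point [x] whose orbit is dense with empty
    interior.  An initial arc of the orbit is compact and has empty interior, so
    the tails of the orbit are still dense ([orbit_tail_dense]), and the orbit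
    never repeats a point ([eventually_periodic_orbit]).  Recurrence of the flow
    must then be turned into recurrence of [f].  When [phi t x] approaches [w]
    for large [t], the remainders of [t] modulo [tau] accumulate at some phase
    [r]; flowing for the missing time shows that the [f]-orbit of [x] accumulates
    at [phi (k * tau - r) w] as soon as [k * tau > r] ([phase_iter]).  With [w]
    the periodic point this gives [q].  With [w = x] it gives
    recurrence provided that the phase is 0; the phases of the returns of
    [x] to itself are closed under addition, and multiples of any [r] come back
    close to 0 modulo [tau], so 0 is one of them ([phase_zero]).  Hence the
    [f]-orbit of [x] accumulates at [y = f x].

    A Devaney chaotic semiflow reduces to this case.  Transitivity and Baire's
    theorem yield a dense orbit ([transitive_dense_orbit]).  If its interior were
    not empty it would run into a periodic orbit; all periodic points would lie
    on that compact orbit, which would be the whole space, and the semiflow would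
    be minimal ([devaney_orbit_interior]). *)

(** * Topologies induced by a metric *)

Lemma near_metric (R : realType) (X : topologicalType) (d : X -> X -> R)
    (dtop : metric_induces_topology d) (x : X) (e : R) :
  0 < e -> \forall y \near x, d x y < e.
Proof. by move=> e0; apply/dtop; exists e. Qed.

Lemma metric_hausdorff (R : realType) (X : topologicalType) (d : X -> X -> R)
    (dist : is_metric d) (dtop : metric_induces_topology d) :
  hausdorff_space X.
Proof.
case: dist => d_ge0 d0 dC dD x y xy; apply/d0/eqP; rewrite -[_ == _]negbK.
apply/negP => dxy; have dxy0 : 0 < d x y by rewrite lt0r dxy d_ge0.
have h : 0 < d x y / 2 by lra.
have [z [/= xz yz]] := xy _ _ (near_metric dtop x h) (near_metric dtop y h).
have := dD x z y; rewrite (dC z y); lra.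
Qed.

Lemma metric_cvg (R : realType) (X : topologicalType) (d : X -> X -> R)
    (dist : is_metric d) (dtop : metric_induces_topology d)
    (u : nat -> X) (l : X) :
  (forall n, d (u n) l < n.+1%:R^-1) -> u @ \oo --> l.
Proof.
case: dist => d_ge0 d0 dC dD ul A /dtop[e e0 eA].
have := near_infty_natSinv_lt (PosNum e0); apply: filterS => n /= ne.
by apply: eA => /=; rewrite dC; exact: lt_trans ne.
Qed.

Lemma near_dist_lt (R : realType) (X : topologicalType) (d : X -> X -> R)
    (dist : is_metric d) (dtop : metric_induces_topology d)
    (g h : X -> X) (x : X) (e : R) :
  {for x, continuous g} -> {for x, continuous h} -> d (g x) (h x) < e ->
  \forall z \near x, d (g z) (h z) < e.
Proof.
case: dist => d_ge0 d0 dC dD cg ch ghe.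
have h0 : 0 < (e - d (g x) (h x)) / 2 by lra.
have ng : \forall z \near x, d (g x) (g z) < (e - d (g x) (h x)) / 2.
  exact: cg (near_metric dtop (g x) h0).
have nh : \forall z \near x, d (h x) (h z) < (e - d (g x) (h x)) / 2.
  exact: ch (near_metric dtop (h x) h0).
apply: filterS2 ng nh => z gz hz.
have := dD (g z) (g x) (h z); have := dD (g x) (h x) (h z).
rewrite (dC (g z) (g x)); lra.
Qed.

Lemma metric_ball_open (R : realType) (X : topologicalType) (d : X -> X -> R)
    (dist : is_metric d) (dtop : metric_induces_topology d) (c : X) (e : R) :
  open [set z | d c z < e].
Proof.
rewrite openE => z /= cz.
apply: (@near_dist_lt _ _ _ dist dtop (cst c) idfun) => //.
exact: cst_continuous.
Qed.

(** * Scrambled sets of a continuous map *)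

Lemma near_forall_leq (T : Type) (F : set_system T) (FF : Filter F)
    (P : nat -> T -> Prop) (M : nat) :
  (forall i, (i <= M)%N -> \forall x \near F, P i x) ->
  \forall x \near F, forall i, (i <= M)%N -> P i x.
Proof.
elim: M => [|M IH] FP.
  by apply: filterS (FP 0%N isT) => x Px i; rewrite leqn0 => /eqP ->.
have FM : \forall x \near F, forall i, (i <= M)%N -> P i x.
  by apply: IH => i iM; apply: FP; exact: leqW.
apply: filterS2 FM (FP M.+1 (leqnn _)) => x PM PS i.
by rewrite leq_eqVlt => /predU1P[->//|]; exact: PM.
Qed.

Lemma continuous_iter (X : topologicalType) (f : X -> X) (n : nat) :
  continuous f -> continuous (iter n f).
Proof.
move=> cf; elim: n => [|n IH] x; first exact: cvg_id.
by apply: (@continuous_comp _ _ _ (iter n f) f); [exact: IH|exact: cf].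
Qed.

Lemma iter_fixed (T : Type) (f : T -> T) (q : T) (n : nat) :
  f q = q -> iter n f q = q.
Proof. by move=> fq; elim: n => //= n ->. Qed.

(** One step of the construction.  The conditions bear on all the iterates of [y]
    with exponent at most [M], which covers every sum of exponents chosen so far,
    and on closed balls of radius [r] around them, which will contain the limit
    points: the time [s] nearly fixes these balls, the time [t] sends them near
    [q], and [2 * r] separates them. *)
Lemma scrambling_stage (R : realType) (X : topologicalType) (d : X -> X -> R)
    (dist : is_metric d) (dtop : metric_induces_topology d)
    (f : X -> X) (y q : X) (cf : continuous f)
    (yinj : injective (fun n => iter n f y))
    (yrec : forall (U : set X) N, nbhs y U ->
       exists2 m, (N <= m)%N & U (iter m f y))
    (fq : f q = q) (yq : forall U : set X, nbhs q U -> exists m, U (iter m f y))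
    (M N : nat) (e : R) : 0 < e ->
  exists r s t, [/\ 0 < r, r <= e, (N <= s)%N,
    forall i z, (i <= M)%N -> d (iter i f y) z <= r ->
      d (iter s f z) z < e /\ d (iter t f z) q < e
  & forall i j, (i <= M)%N -> (j <= M)%N -> i <> j ->
      2 * r < d (iter i f y) (iter j f y)].
Proof.
case: (dist) => d_ge0 d0 dC dD e0.
have dxx x : d x x = 0 by apply/d0.
have [s Ns /= sy] : exists2 s, (N <= s)%N &
    forall i, (i <= M)%N -> d (iter i f (iter s f y)) (iter i f y) < e.
  apply: (yrec (fun x => forall i, (i <= M)%N -> d (iter i f x) (iter i f y) < e)).
  apply: near_forall_leq => i _.
  apply: (@near_dist_lt _ _ _ dist dtop _ (cst (iter i f y))).
  - exact: continuous_iter.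
  - exact: cst_continuous.
  - by rewrite dxx.
have [t /= ty] : exists t, forall i, (i <= M)%N ->
    d (iter i f (iter t f y)) q < e.
  apply: (yq (fun x => forall i, (i <= M)%N -> d (iter i f x) q < e)).
  apply: near_forall_leq => i _.
  apply: (@near_dist_lt _ _ _ dist dtop _ (cst q)).
  - exact: continuous_iter.
  - exact: cst_continuous.
  - by rewrite iter_fixed// dxx.
have near_good : \forall r \near 0^'+, forall i, (i <= M)%N -> forall z,
    d (iter i f y) z <= r -> d (iter s f z) z < e /\ d (iter t f z) q < e.
  apply: near_forall_leq => i iM.
  have gs : \forall z \near iter i f y, d (iter s f z) z < e.
    apply: (@near_dist_lt _ _ _ dist dtop _ idfun).
    - exact: continuous_iter.
    - exact: cvg_id.
    - by rewrite -iterD addnC iterD sy.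
  have gt : \forall z \near iter i f y, d (iter t f z) q < e.
    apply: (@near_dist_lt _ _ _ dist dtop _ (cst q)).
    - exact: continuous_iter.
    - exact: cst_continuous.
    - by rewrite -iterD addnC iterD ty.
  have [r0 r00 r0P] := (dtop _ _).1 (filterI gs gt).
  apply: filterS (nbhs_right_lt r00) => r rr0 z zr.
  by apply: r0P => /=; exact: le_lt_trans rr0.
have near_sep : \forall r \near 0^'+, forall i, (i <= M)%N -> forall j,
    (j <= M)%N -> i <> j -> 2 * r < d (iter i f y) (iter j f y).
  apply: near_forall_leq => i iM; apply: near_forall_leq => j jM.
  have [->|/eqP ij] := eqVneq i j; first exact: filterE.
  have dij : 0 < d (iter i f y) (iter j f y) / 2.
    rewrite divr_gt0// lt0r d_ge0 andbT; apply/eqP => /d0 /yinj //.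
  by apply: filterS (nbhs_right_lt dij) => r + _; lra.
have near_e : \forall r \near 0^'+, 0 < r /\ r <= e.
  near=> r; split; first by near: r; exact: nbhs_right_gt.
  by near: r; exact: nbhs_right_le.
have [r [[[r0 re] rgood] rsep]] := filter_ex (filterI (filterI near_e near_good) near_sep).
exists r, s, t; split => // [i z iM|i j iM]; first exact: rgood.
exact: rsep.
Unshelve. all: by end_near. Qed.

(** When each term exceeds the sum of the preceding ones, the top digit can be
    read off the sum, as with powers of two. *)
Lemma superincreasing_digits (m : nat -> nat) (a b : nat -> bool) (n : nat) :
  (forall k, (\sum_(i < k) m i < m k)%N) ->
  (\sum_(i < n) a i * m i = \sum_(i < n) b i * m i)%N ->
  forall i, (i < n)%N -> a i = b i.
Proof.
move=> msup.
have le (c : nat -> bool) k : (\sum_(i < k) c i * m i <= \sum_(i < k) m i)%N.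
  by apply: leq_sum => i _; case: (c i); rewrite ?mul1n ?mul0n.
elim: n => [//|n IH]; rewrite !big_ord_recr/=.
move: (leq_ltn_trans (le a n) (msup n)) (leq_ltn_trans (le b n) (msup n)) IH.
move: (\sum_(i < n) a i * m i)%N (\sum_(i < n) b i * m i)%N => A B Am Bm IH AB.
have abn : a n = b n by case: (a n) (b n) AB => -[] //=; lia.
move: AB; rewrite abn => /addIn/IH ab i.
by rewrite ltnS leq_eqVlt => /predU1P[->//|]; exact: ab.
Qed.

(** The times [s n] and [t n] do not depend on the point of the Cantor set, so
    they serve all tuples of its points simultaneously.  The lower bounds [N] are
    what keeps the return times outside prescribed compact sets. *)
Lemma scrambled_cantor_set (R : realType) (X : topologicalType)
    (d : X -> X -> R) (dist : is_metric d) (dtop : metric_induces_topology d)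
    (dcomplete : metric_complete d) (f : X -> X) (y q : X) (cf : continuous f)
    (yinj : injective (fun n => iter n f y))
    (yrec : forall (U : set X) N, nbhs y U ->
       exists2 m, (N <= m)%N & U (iter m f y))
    (fq : f q = q) (yq : forall U : set X, nbhs q U -> exists m, U (iter m f y))
    (N : nat -> nat) :
  exists (z : (nat -> bool) -> X) (s t : nat -> nat),
    [/\ injective z, forall n, (N n <= s n)%N,
        forall a, iter (s n) f (z a) @[n --> \oo] --> z a
      & forall a, iter (t n) f (z a) @[n --> \oo] --> q].
Proof.
(* [w (n, M)] is the triple radius, return time, time towards [q]. *)
have /choice[w wP] : forall A : nat * nat, exists w : R * nat * nat,
  [/\ 0 < w.1.1, w.1.1 <= A.1.+1%:R^-1, (N A.1 <= w.1.2)%N,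
    forall i z, (i <= A.2)%N -> d (iter i f y) z <= w.1.1 ->
      d (iter w.1.2 f z) z < A.1.+1%:R^-1 /\
      d (iter w.2 f z) q < A.1.+1%:R^-1
  & forall i j, (i <= A.2)%N -> (j <= A.2)%N -> i <> j ->
      2 * w.1.1 < d (iter i f y) (iter j f y)].
  move=> [n M]; have e0 : 0 < n.+1%:R^-1 :> R by [].
  have [r [s [t H]]] :=
    scrambling_stage dist dtop cf yinj yrec fq yq M (N n) e0.
  by exists (r, s, t).
case: (dist) => d_ge0 d0 dC dD; have dxx x : d x x = 0 by apply/d0.
(* The next exponent exceeds the sum [A.1] of the previous ones and moves the
   iterates built from them by less than half of the current radius. *)
have /choice[nxt nxtP] : forall A : nat * R, exists m : nat, 0 < A.2 ->
    (A.1 < m)%N /\ forall i, (i <= A.1)%N ->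
      d (iter i f y) (iter (i + m) f y) < A.2 / 2.
  move=> [M r]; have [r0|r0] := ltP 0 r; last by exists 0%N.
  suff [m Mm mP] : exists2 m, (M.+1 <= m)%N & forall i, (i <= M)%N ->
      d (iter i f y) (iter i f (iter m f y)) < r / 2.
    by exists m => _; split=> // i iM; rewrite iterD; exact: mP.
  apply: (yrec (fun x => forall i, (i <= M)%N ->
    d (iter i f y) (iter i f x) < r / 2)).
  apply: near_forall_leq => i _.
  apply: (@near_dist_lt _ _ _ dist dtop (cst (iter i f y))).
  - exact: cst_continuous.
  - exact: continuous_iter.
  - by rewrite dxx; lra.
(* The state is the sum of the exponents chosen so far and the radius. *)
pose st := fix st n : nat * R := if n is n'.+1 then
    let M := ((st n').1 + nxt (st n'))%N in
    (M, Num.min (w (n, M)).1.1 ((st n').2 / 2))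
  else (0%N, (w (0%N, 0%N)).1.1).
pose m n := nxt (st n); pose M n := (st n).1; pose r n := (st n).2.
have MS n : M n.+1 = (M n + m n)%N by [].
have r_gt0 n : 0 < r n.
  elim: n => [|n IH]; first by have [] := wP (0%N, 0%N).
  rewrite /r/= lt_min divr_gt0// andbT.
  by have [] := wP (n.+1, M n.+1).
have rw n : r n <= (w (n, M n)).1.1.
  by case: n => [|n]; rewrite /r/= ?lexx// ge_min lexx.
have r_half n : r n.+1 <= r n / 2 by rewrite /r/= ge_min lexx orbT.
have mP n : (M n < m n)%N /\ forall i, (i <= M n)%N ->
    d (iter i f y) (iter (i + m n) f y) < r n / 2.
  exact: (nxtP (st n)) (r_gt0 n).
have ME n : M n = (\sum_(i < n) m i)%N.
  by elim: n => [|n IH]; rewrite ?big_ord0// big_ord_recr/= -IH MS.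
pose e (a : nat -> bool) n := (\sum_(i < n) a i * m i)%N.
have eM a n : (e a n <= M n)%N.
  by rewrite ME; apply: leq_sum => i _; case: (a i); rewrite ?mul1n ?mul0n.
pose u a n := iter (e a n) f y.
have u_step a n : d (u a n) (u a n.+1) < r n / 2.
  rewrite /u /e big_ord_recr/=; case: (a n).
    by rewrite mul1n; apply: (mP n).2; exact: eM.
  by rewrite mul0n addn0 dxx divr_gt0.
have u_ball a k n : d (u a n) (u a (n + k)%N) < r n.
  elim: k n => [|k IH] n; first by rewrite addn0 dxx.
  have := IH n.+1; rewrite addSnnS.
  have := dD (u a n) (u a n.+1) (u a (n + k.+1)%N); have := u_step a n.
  have := r_half n; lra.
have u_cauchy a (eps : R) : 0 < eps -> exists k : nat, forall i j : nat,
    (k <= i)%N -> (k <= j)%N -> d (u a i) (u a j) < eps.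
  move=> eps0; have h0 : 0 < eps / 2 by lra.
  have [k _ /(_ k (leqnn k)) /= kP] := near_infty_natSinv_lt (PosNum h0).
  have rk : r k < eps / 2.
    apply: le_lt_trans kP; apply: le_trans (rw k) _.
    by have [] := wP (k, M k).
  exists k => i j ki kj.
  have := u_ball a (i - k)%N k; have := u_ball a (j - k)%N k.
  rewrite !subnKC//; have := dD (u a i) (u a k) (u a j).
  rewrite (dC (u a i) (u a k)); lra.
have u_cvg a : exists z : X, u a @ \oo --> z.
  by apply: dcomplete; exact: u_cauchy.
have [z zP] := choice u_cvg.
have z_ball a n : d (u a n) (z a) <= r n.
  apply/ler_addgt0Pl => eps eps0.
  have [k _ kP] := zP a _ (near_metric dtop (z a) eps0).
  have := kP (n + k)%N (leq_addl _ _) => /=.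
  have := u_ball a k n; have := dD (u a n) (u a (n + k)%N) (z a).
  rewrite (dC (z a)); lra.
have zr a n := le_trans (z_ball a n) (rw n).
exists z, (fun n => (w (n, M n)).1.2), (fun n => (w (n, M n)).2); split.
- move=> a b zab; apply/funext => i.
  apply: (@superincreasing_digits m a b i.+1) => //.
    by move=> k; rewrite -ME; exact: (mP k).1.
  apply: contrapT => eab.
  have [_ _ _ _ sep] := wP (i.+1, M i.+1).
  have := sep _ _ (eM a i.+1) (eM b i.+1) eab => /=.
  have := zr a i.+1; have := zr b i.+1; rewrite /u.
  have := dD (u a i.+1) (z a) (u b i.+1); rewrite {2}zab (dC (z b)) /u; lra.
- by move=> n; have [] := wP (n, M n).
- move=> a; apply: (@metric_cvg _ _ d) => // n; have [_ _ _ H _] := wP (n, M n).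
  exact: (H _ _ (eM a n) (zr a n)).1.
- move=> a; apply: (@metric_cvg _ _ d) => // n; have [_ _ _ H _] := wP (n, M n).
  exact: (H _ _ (eM a n) (zr a n)).2.
Qed.

(** * Orbits of a semiflow *)

(** Restricting to [0 <= b] in the conclusion makes the statement usable at
    [a = 0], where continuity is one-sided in time. *)
Lemma semiflow_jointly_continuous (R : realType) (X : topologicalType)
    (phi : R -> X -> X) (flow : semiflow phi) (a : R) (w : X) (U : set X) :
  0 <= a -> nbhs (phi a w) U ->
  exists2 e : R, 0 < e & \forall z \near w, forall b, 0 <= b -> `|b - a| < e ->
    U (phi b z).
Proof.
move=> a0 Uaw; case: flow => /subspace_continuousP cphi _ _.
have [[A B] [/= /nbhs_ballP[e /= e0 eA] wB] AB] :
    nbhs (a, w) (fun z => (Rplus R `*` [set: X]) z -> U (phi z.1 z.2)).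
  exact: (cphi (a, w) (conj a0 I) U Uaw).
exists e => //; apply: filterS wB => z Bz b b0 bae.
apply: (AB (b, z)); split => //=; apply: eA.
by rewrite /ball/= distrC.
Qed.

Lemma time_map_continuous (R : realType) (X : topologicalType)
    (phi : R -> X -> X) (flow : semiflow phi) (a : R) :
  0 <= a -> continuous (phi a).
Proof.
move=> a0 w U /(semiflow_jointly_continuous flow a0)[e e0].
by apply: filterS => z; apply => //; rewrite subrr normr0.
Qed.

Lemma orbit_arc_closed (R : realType) (X : topologicalType)
    (hX : hausdorff_space X) (phi : R -> X -> X) (flow : semiflow phi)
    (x : X) (c : R) :
  closed [set phi t x | t in `[0, c]].
Proof.
apply: compact_closed => //.
apply: (@continuous_compact _ _ (phi^~ x)); last exact: segment_compact.
apply/subspace_continuousP => a /=; rewrite in_itv/= => /andP[a0 _] U.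
move=> /(semiflow_jointly_continuous flow a0)[e e0 /nbhs_singleton eU].
rewrite /nbhs/= /within/=; near=> b => /=; rewrite in_itv/= => /andP[b0 _].
by apply: eU => //; near: b; exact: nbhsr0P.
Unshelve. all: by end_near. Qed.

Lemma iter_time_map (R : realType) (X : topologicalType)
    (phi : R -> X -> X) (flow : semiflow phi) (tau : R) (x : X) (n : nat) :
  0 <= tau -> iter n (phi tau) x = phi (n%:R * tau) x.
Proof.
case: flow => _ phiD phi0 tau0.
elim: n => [|n IH]; first by rewrite mul0r phi0.
rewrite iterS IH phiD//= /Rplus/= ?mulr_ge0//.
by rewrite -natr1 mulrDl mul1r addrC.
Qed.

(** Every time beyond [c] can be lowered by the period [c - b]. *)
Lemma eventually_periodic_orbit (R : realType) (X : topologicalType)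
    (phi : R -> X -> X) (flow : semiflow phi) (x : X) (b c : R) :
  0 <= b -> b < c -> phi b x = phi c x ->
  semi_orbit phi x = [set phi t x | t in `[0, c]].
Proof.
case: flow => _ phiD phi0 b0 bc xbc.
have c0 : 0 <= c by lra.
apply/seteqP; split=> [_ [t t0 <-]|_ [t /= + <-]]; last first.
  by rewrite in_itv/= => /andP[t0 _]; exists t.
rewrite /Rplus/= in t0.
suff H n : forall t, 0 <= t -> t < c + n%:R * (c - b) ->
    exists2 s, s \in `[0, c] & phi s x = phi t x.
  have [||s s0 <-] := H (Num.bound (t / (c - b))) t; [by []| |by exists s].
  have : t / (c - b) < (Num.bound (t / (c - b)))%:R.
    by apply: archi_boundP; rewrite divr_ge0//; lra.
  rewrite ltr_pdivrMr; [lra|lra].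
elim: n => [|n IH] {t0}t t0 tn.
  by exists t => //; rewrite in_itv/= t0/=; lra.
have [tc|ct] := leP t c; first by exists t; rewrite // in_itv/= t0.
have [||s s0 sx] := IH (t - (c - b)).
- lra.
- by move: tn; rewrite -natr1 mulrDl; lra.
exists s => //; rewrite sx.
have -> : t - (c - b) = (t - c) + b by lra.
rewrite -phiD ?xbc /Rplus/= ?phiD /Rplus/= ?subrK//; lra.
Qed.

(** A neighbourhood missed by the tail of a dense orbit would lie in an initial
    arc, which is closed, hence in the interior of the orbit. *)
Lemma orbit_tail_dense (R : realType) (X : topologicalType)
    (hX : hausdorff_space X) (phi : R -> X -> X) (flow : semiflow phi)
    (x : X) (xdense : dense (semi_orbit phi x))
    (xint : interior (semi_orbit phi x) = set0)
    (w : X) (U : set X) (N : nat) :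
  nbhs w U -> exists2 t, N%:R <= t & U (phi t x).
Proof.
rewrite nbhsE => -[V [oV Vw] VU].
pose A := [set phi t x | t in `[0, N%:R]].
have cA : closed A by exact: orbit_arc_closed.
have [[v [Vv nAv]]|VA] := pselect ((V `&` ~` A) !=set0).
  have [|v' [[Vt nAt] [t t0 tx]]] := xdense (V `&` ~` A) (ex_intro _ v (conj Vv nAv)).
    by apply: openI => //; exact: closed_openC.
  rewrite -tx in Vt nAt; exists t; last exact: VU.
  rewrite leNgt; apply/negP => tN; apply: nAt; exists t => //=.
  by rewrite in_itv/= t0 ltW.
have : interior (semi_orbit phi x) w.
  rewrite /interior nbhsE; exists V => // v Vv.
  have /contrapT[t /= + <-] : ~ ~ A v by move=> nAv; apply: VA; exists v.
  by rewrite in_itv/= => /andP[t0 _]; exists t.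
by rewrite xint.
Qed.

(** * Phases of return times modulo a period *)

Lemma interval_cluster (R : realType) (c : R) (u : nat -> R) :
  (forall n, 0 <= u n <= c) ->
  exists2 r, 0 <= r <= c & forall e, 0 < e -> forall N : nat,
    exists2 n, (N <= n)%N & `|u n - r| < e.
Proof.
move=> uc; have [|r [rc ur]] := @segment_compact R 0 c (u @ \oo) _.
  by exists 0%N => // n _ /=; rewrite in_itv/= uc.
exists r; first by move: rc; rewrite /= in_itv.
move=> e e0 N.
have [|_ [[n /= Nn <-] une]] := ur (u @` [set n | (N <= n)%N]) _ _ (nbhsx_ballx r e e0).
  by exists N => // n Nn; exists n.
by exists n => //; rewrite distrC.
Qed.

(** [r] is a phase when it is a limit, modulo [tau], of arbitrarily large times at
    which the orbit of [x] comes arbitrarily close to [w]. *)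
Definition phase (R : realType) (X : topologicalType) (phi : R -> X -> X)
    (tau : R) (x w : X) (r : R) : Prop :=
  forall (U : set X) (e : R) (N : nat), nbhs w U -> 0 < e ->
    exists t (m : nat),
      [/\ N%:R <= t, `|t - (r + m%:R * tau)| < e & U (phi t x)].

(** The remainders modulo [tau] of the approach times live in a compact
    interval. *)
Lemma phase_exists (R : realType) (X : topologicalType)
    (d : X -> X -> R) (dist : is_metric d) (dtop : metric_induces_topology d)
    (phi : R -> X -> X) (tau : R) (x w : X) :
  0 < tau ->
  (forall (U : set X) (N : nat), nbhs w U -> exists2 t, N%:R <= t & U (phi t x)) ->
  exists2 r, 0 <= r <= tau & phase phi tau x w r.
Proof.
move=> tau0 xw.
have approach n : exists t, n%:R <= t /\ d w (phi t x) < n.+1%:R^-1.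
  have n0 : 0 < n.+1%:R^-1 :> R by [].
  by have [t nt wt] := xw _ n (near_metric dtop w n0); exists t.
have [t tP] := choice approach.
pose m n := Num.trunc (t n / tau).
have mP n : (m n)%:R * tau <= t n < (m n).+1%:R * tau.
  have [nt _] := tP n.
  have /truncn_itv : 0 <= t n / tau.
    by rewrite divr_ge0 ?(ltW tau0)//; exact: le_trans nt.
  by rewrite ler_pdivlMr// ltr_pdivrMr.
have [|r rtau rcl] := @interval_cluster _ tau (fun n => t n - (m n)%:R * tau).
  move=> n; have /andP[] := mP n; rewrite -natr1 mulrDl; lra.
exists r => // U e N /dtop[eps eps0 epsU] e0.
have [k _ /(_ _ (leqnn _)) /= kP] := near_infty_natSinv_lt (PosNum eps0).
have [n Nn rn] := rcl e e0 (maxn N k); exists (t n), (m n).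
have [nt wt] := tP n; move: Nn; rewrite geq_max => /andP[Nn kn]; split.
- by apply: le_trans nt; rewrite ler_nat.
- by rewrite opprD addrA addrAC.
- apply: epsU; apply: lt_trans wt _; apply: le_lt_trans kP.
  by rewrite lef_pV2 ?posrE// ler_nat.
Qed.

(** After a first return [phi t x] close to [x], a second return time [t'] chosen
    in terms of the continuity of [phi t] makes [t + t'] a return time. *)
Lemma phaseD (R : realType) (X : topologicalType)
    (phi : R -> X -> X) (flow : semiflow phi) (tau : R) (x : X) (r s : R) :
  phase phi tau x x r -> phase phi tau x x s -> phase phi tau x x (r + s).
Proof.
move=> pr ps U e N xU e0; have e20 : 0 < e / 2 by lra.
have [t [m [Nt tr Ut]]] := pr _ _ N (nbhs_interior xU) e20.
have t0 : 0 <= t by exact: le_trans Nt.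
have Vx : \forall z \near x, U (phi t z).
  by apply: (time_map_continuous flow t0); exact: Ut.
have [t' [m' [t'0 ts Ut']]] := ps _ _ 0%N Vx e20.
exists (t + t'), (m + m')%N; split.
- by apply: le_trans Nt _; rewrite lerDl.
- have -> : t + t' - (r + s + (m + m')%:R * tau) =
    (t - (r + m%:R * tau)) + (t' - (s + m'%:R * tau)).
    by rewrite natrD mulrDl; lra.
  apply: le_lt_trans (ler_normD _ _) _; lra.
- by case: flow => _ phiD _; rewrite -phiD.
Qed.

(** By compactness two multiples [k * r] and [l * r], with [k < l], are almost
    equal modulo [tau], so that the phase [(l - k) * r] is almost 0. *)
Lemma phase_zero (R : realType) (X : topologicalType)
    (phi : R -> X -> X) (flow : semiflow phi) (tau : R) (x : X) (r : R) :
  0 < tau -> 0 <= r -> phase phi tau x x r -> phase phi tau x x 0.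
Proof.
move=> tau0 r0 pr U e N xU e0; have e20 : 0 < e / 2 by lra.
have e40 : 0 < e / 4 by lra.
have pmul k : phase phi tau x x (k.+1%:R * r).
  elim: k => [|k IH]; first by rewrite mul1r.
  by rewrite -natr1 mulrDl mul1r; exact: phaseD.
pose m (k : nat) := Num.trunc (k%:R * r / tau).
have mP k : (m k)%:R * tau <= k%:R * r < (m k).+1%:R * tau.
  have /truncn_itv : 0 <= k%:R * r / tau by rewrite divr_ge0 ?mulr_ge0 ?(ltW tau0).
  by rewrite ler_pdivlMr// ltr_pdivrMr.
have [|c _ ccl] := @interval_cluster _ tau (fun k => k%:R * r - (m k)%:R * tau).
  move=> n; have /andP[] := mP n; rewrite -natr1 mulrDl; lra.
have [k _ kc] := ccl _ e40 0%N; have [l kl lc] := ccl _ e40 k.+1.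
have mkl : (m k <= m l)%N.
  by apply: le_truncn; rewrite ler_pM2r ?invr_gt0// ler_wpM2r// ler_nat ltnW.
have [t [n [Nt tn Ut]]] := pmul (l - k.+1)%N _ _ N xU e20.
exists t, (m l - m k + n)%N; split=> //.
have := tn; rewrite -subSn// subSS natrB 1?ltnW// natrD natrB// => {}tn.
move: kc lc tn; rewrite ?(mulrBl, mulrDl) !ltr_norml.
move=> /andP[? ?] /andP[? ?] /andP[? ?]; apply/andP; split; lra.
Qed.

(** At a time [t] close to [r + m * tau] with [phi t x] close to [w], flowing for
    the further time [(m + k) * tau - t], close to [k * tau - r], ends at an
    iterate of [phi tau].  The strict inequality [r < k * tau] keeps that further
    time nonnegative. *)
Lemma phase_iter (R : realType) (X : topologicalType)
    (phi : R -> X -> X) (flow : semiflow phi) (tau : R) (x w : X) (r : R)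
    (k : nat) :
  0 < tau -> 0 <= r -> r < k%:R * tau -> phase phi tau x w r ->
  forall (U : set X) (N : nat), nbhs (phi (k%:R * tau - r) w) U ->
    exists2 n, (N <= n)%N & U (iter n (phi tau) x).
Proof.
move=> tau0 r0 rk pr U N; have a0 : 0 <= k%:R * tau - r by lra.
move=> /(semiflow_jointly_continuous flow a0)[e e0 wU].
pose e' := Num.min e (k%:R * tau - r).
have e'0 : 0 < e' by rewrite lt_min e0/=; lra.
have [t [m [Mt tr]]] :=
  pr _ _ (Num.bound (N%:R * tau + r + e')) wU e'0.
have tN : N%:R * tau + r + e' <= t.
  apply: le_trans Mt; apply/ltW/archi_boundP.
  by rewrite !addr_ge0// ?mulr_ge0// ltW.
move: tr; rewrite ltr_norml => /andP[tr1 tr2].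
have [ee ek] : e' <= e /\ e' <= k%:R * tau - r by split; rewrite ge_min lexx ?orbT.
have t0 : 0 <= t by have := mulr_ge0 (ler0n R N) (ltW tau0); lra.
move=> /(_ ((m + k)%:R * tau - t)) Ut; exists (m + k)%N.
  suff : N%:R <= m%:R :> R by rewrite ler_nat => /leq_trans -> //; exact: leq_addr.
  by rewrite -(ler_pM2r tau0); lra.
rewrite natrD mulrDl in Ut.
have b0 : 0 <= m%:R * tau + k%:R * tau - t by lra.
have := Ut b0; rewrite (iter_time_map flow) ?ltW// natrD mulrDl.
have [_ phiD _] := flow; rewrite phiD// subrK; apply.
by rewrite ltr_norml; apply/andP; split; lra.
Qed.

(** * Chaos from a dense orbit with empty interior *)

(** Applying syndeticity at time 1 produces a period that is at least 1. *)
Lemma periodic_point_period (R : realType) (X : topologicalType)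
    (phi : R -> X -> X) (p : X) :
  periodic_point phi p -> exists2 tau, 0 < tau & phi tau p = p.
Proof.
move=> [K [K0 _ /(_ 1)]]; rewrite /Rplus/= => /(_ ler01)[_ [[k Kk <-] [_ kp]]].
by exists (k + 1) => //; have := K0 _ Kk; rewrite /Rplus/=; lra.
Qed.

(** Cantor's diagonal argument. *)
Lemma cantor_range_uncountable (X : Type) (z : (nat -> bool) -> X) :
  injective z -> ~ countable (range z).
Proof.
move=> zinj /countable_injP[g ginj].
have zmem a : z a \in range z by apply/mem_set; exists a.
pose D n := ~~ `[< exists a, g (z a) = n /\ a n >].
have DE : D (g (z D)) = ~~ D (g (z D)).
  rewrite {1}/D; congr (~~ _); apply/asboolP/idP => [[a [e ag]]|Dg].
    by have /zinj aD := ginj _ _ (zmem a) (zmem D) e; rewrite -{1}aD.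
  by exists D.
by move: DE; case: (D _).
Qed.

Lemma ptws_cvg (I : Type) (X : topologicalType) (u : nat -> {ptws I -> X})
    (l : {ptws I -> X}) :
  (forall i, (fun n => u n i) @ \oo --> l i) -> u @ \oo --> l.
Proof.
move=> ul; apply/cvg_sup => i.
rewrite cvg_image; last by rewrite eqEsubset; split=> v // _; exists (cst v).
apply: cvg_trans (ul i) => W Wu; exists (@^~ i @^-1` W) => //.
by rewrite image_preimage// eqEsubset; split=> // v _; exists (fun=> v).
Qed.

(** The map is [phi tau] and the base point is [phi tau x] rather than [x]: return
    times slightly larger than a multiple of [tau] can only be completed to the
    next multiple, so that the iterates of [x] approach [phi tau x]. *)
Lemma dense_orbit_chaotic (R : realType) (X : topologicalType)
    (phi : R -> X -> X) (X_polish : polish_space R X) (flow : semiflow phi)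
    (x : X) (xdense : dense (semi_orbit phi x))
    (xint : interior (semi_orbit phi x) = set0) (p : X)
    (pper : periodic_point phi p) : multidim_li_yorke_chaotic phi.
Proof.
case: X_polish => _ [d [dist dtop dcomplete]].
have hX := metric_hausdorff dist dtop.
have [tau tau0 ptau] := periodic_point_period pper.
have tau_ge0 := ltW tau0.
have [_ phiD phi0] := flow.
have tail := orbit_tail_dense hX flow xdense xint.
have orbit_inj b c : 0 <= b -> 0 <= c -> phi b x = phi c x -> b = c.
  wlog bc : b c / b < c => [hw b0 c0 xbc|b0 c0 xbc].
    case: (ltgtP b c) => [bc|cb|//]; first exact: hw.
    by apply/esym/hw.
  have xT : semi_orbit phi x = [set: X].
    apply/seteqP; split=> // z _; rewrite (eventually_periodic_orbit flow b0 bc xbc).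
    apply: (orbit_arc_closed hX flow) => U zU.
    have [t t0 Ut] := tail z U 0%N zU.
    exists (phi t x); split => //.
    by rewrite -(eventually_periodic_orbit flow b0 bc xbc); exists t.
  by move: xint; rewrite xT interiorT => /seteqP[/(_ x I)].
have [r /andP[r0 rtau] xr] := phase_exists dist dtop tau0 (tail x).
have [s /andP[s0 stau] ps] := phase_exists dist dtop tau0 (tail p).
(* With [k = 1] the strict inequality of [phase_iter] fails if [s = tau]. *)
have tau2 : s < 2%:R * tau by lra.
have a0 : 0 <= 2%:R * tau - s by lra.
pose f := phi tau; pose y := f x; pose q := phi (2%:R * tau - s) p.
have yE n : iter n f y = phi (n.+1%:R * tau) x.
  by rewrite /y -iterSr (iter_time_map flow).
have shift (U : set X) (N : nat) :
    (forall N, exists2 n, (N <= n)%N & U (iter n f x)) ->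
    exists2 n, (N <= n)%N & U (iter n f y).
  move=> /(_ N.+1)[[//|n] Nn Un]; exists n => //.
  by rewrite /y -iterSr.
have tau1 : 0 < 1%:R * tau by lra.
have yrec (U : set X) N : nbhs y U -> exists2 n, (N <= n)%N & U (iter n f y).
  move=> yU; apply: shift => M.
  apply: (phase_iter flow tau0 (lexx 0) tau1 (phase_zero flow tau0 r0 xr)).
  by rewrite mul1r subr0.
have yq (U : set X) : nbhs q U -> exists n, U (iter n f y).
  move=> qU; have [|n _] := shift U 0%N; last by exists n.
  by move=> M; apply: (phase_iter flow tau0 s0 tau2 ps).
have fq : f q = q.
  rewrite /f /q phiD// addrC -phiD//; congr phi; exact: ptau.
have yinj : injective (fun n => iter n f y).
  move=> i j; rewrite !yE => /orbit_inj; rewrite !mulr_ge0// => /(_ isT isT).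
  by move/(mulIf (lt0r_neq0 tau0))/eqP; rewrite eqr_nat eqSS => /eqP.
move=> F F0 Fc _.
have Fb n : exists N : nat, forall t, F n t -> t < N%:R * tau.
  have [M [_ /(_ (M + 1))]] := compact_bounded (Fc n).
  rewrite ltrDl ltr01 => /(_ isT) MF.
  exists (Num.bound ((M + 1) / tau)) => t Ft.
  have tM : t <= M + 1 by apply: le_trans (ler_norm t) (MF t Ft).
  have t0 : 0 <= t by exact: F0 Ft.
  apply: (le_lt_trans tM); rewrite -ltr_pdivrMr//.
  apply: archi_boundP; apply: divr_ge0; last exact: ltW.
  exact: le_trans tM.
have [N NP] := choice Fb.
have cf : continuous f by exact: time_map_continuous.
have [z [k [l [zinj Nk zk zl]]]] :=
  scrambled_cantor_set dist dtop dcomplete cf yinj yrec fq yq N.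
exists (range z); split; first exact: cantor_range_uncountable.
move=> n u _ _ uz; exists (fun n => (k n)%:R * tau), (fun n => (l n)%:R * tau), q.
split.
- by move=> i; rewrite /Rplus/= !mulr_ge0.
- by move=> i /NP; rewrite ltr_pM2r// ltr_nat ltnNge Nk.
- apply: ptws_cvg => i; have [a _ az] := uz i; rewrite -az.
  have := zk a; under eq_fun do rewrite (iter_time_map flow)//.
  by rewrite /diag_act az.
- apply: ptws_cvg => i; have [a _ az] := uz i.
  have := zl a; under eq_fun do rewrite (iter_time_map flow)//.
  by rewrite /diag_act -az.
Qed.

(** * Devaney chaos *)

(** Baire's category theorem, by nested closed balls. *)
Lemma polish_baire (R : realType) (X : topologicalType) (d : X -> X -> R)
    (dist : is_metric d) (dtop : metric_induces_topology d)
    (dcomplete : metric_complete d) (x : X) (G : nat -> set X) :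
  (forall n, open (G n)) -> (forall n, dense (G n)) -> exists z, forall n, G n z.
Proof.
case: (dist) => d_ge0 d0 dC dD Go Gd.
have dxx z : d z z = 0 by apply/d0.
have shrink (A : nat * X * R) : exists B : X * R, 0 < A.2 ->
    [/\ 0 < B.2, B.2 <= A.1.1.+1%:R^-1 & forall z, d B.1 z <= B.2 ->
      d A.1.2 z < A.2 /\ G A.1.1 z].
  case: A => [[n c] r] /=; have [r0|r0] := ltP 0 r; last by exists (c, r).
  have [|z [cz Gz]] := Gd n _ _ (metric_ball_open dist dtop c r).
    by exists c; rewrite /= dxx.
  have /dtop[e e0 eP] : nbhs z ([set z | d c z < r] `&` G n).
    apply: open_nbhs_nbhs; split; last by [].
    by apply: openI => //; exact: metric_ball_open.
  have n0 : 0 < n.+1%:R^-1 :> R by [].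
  exists (z, Num.min (e / 2) n.+1%:R^-1) => _; split => /=.
  - by rewrite lt_min n0 divr_gt0.
  - by rewrite ge_min lexx orbT.
  - move=> v zv; apply: eP => /=; apply: le_lt_trans zv _.
    by rewrite gt_min; apply/orP; left; lra.
have [next nextP] := choice shrink.
pose st := fix st n : X * R :=
  if n is n'.+1 then next (n', (st n').1, (st n').2) else (x, 1).
have r_gt0 n : 0 < (st n).2.
  by elim: n => [|n IH] /=; [exact: ltr01|have [] := nextP (n, (st n).1, (st n).2) IH].
have stepP n := nextP (n, (st n).1, (st n).2) (r_gt0 n).
have nested k n z : d (st (n + k)%N).1 z <= (st (n + k)%N).2 ->
    d (st n).1 z <= (st n).2.
  elim: k n => [|k IH] n; first by rewrite addn0.
  rewrite addnS -addSn => /IH zn; have [_ _ H] := stepP n.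
  by apply: ltW; exact: (H z zn).1.
have ball k n : (k <= n)%N -> d (st k).1 (st n).1 <= (st k).2.
  by move=> kn; apply: (nested (n - k)%N); rewrite subnKC// dxx ltW.
have [e e0|z zP] := dcomplete (fun n => (st n).1).
  have h0 : 0 < e / 2 by lra.
  have [k _ /(_ k (leqnn k)) /= kP] := near_infty_natSinv_lt (PosNum h0).
  have rk : (st k.+1).2 < e / 2.
    by have [_ rk _] := stepP k; exact: le_lt_trans rk kP.
  exists k.+1 => m n /ball km /ball kn.
  have := dD (st m).1 (st k.+1).1 (st n).1; rewrite (dC (st m).1 (st k.+1).1).
  lra.
have z_in n : d (st n).1 z <= (st n).2.
  apply/ler_addgt0Pl => eps eps0.
  have [k _ kP] := zP _ (near_metric dtop z eps0).
  have := kP (n + k)%N (leq_addl _ _) => /=.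
  have := ball n (n + k)%N (leq_addr _ _).
  have := dD (st n).1 (st (n + k)%N).1 z.
  rewrite (dC z); lra.
by exists z => n; have [_ _ H] := stepP n; exact: (H z (z_in n.+1)).2.
Qed.

Lemma transitive_dense_orbit (R : realType) (X : topologicalType)
    (phi : R -> X -> X) (X_polish : polish_space R X) (flow : semiflow phi)
    (x : X) : topologically_transitive phi ->
  exists x0, dense (semi_orbit phi x0).
Proof.
move=> trans; case: X_polish => -[D /countable_injP[f finj] Ddense].
move=> [d [dist dtop dcomplete]]; case: (dist) => d_ge0 d0 dC dD.
have dxx z : d z z = 0 by apply/d0.
(* A sequence [g] that runs through [D]. *)
have enum n : exists c, forall c', D c' -> f c' = n -> c = c'.
  have [[c [Dc fc]]|nc] := pselect (exists c, D c /\ f c = n).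
    by exists c => c' Dc' fc'; apply: finj; rewrite ?inE// fc.
  by exists x => c' Dc' fc'; case: nc; exists c'.
have [g gP] := choice enum.
pose V (A : nat * nat) := [set z | d (g A.1) z < A.2.+1%:R^-1].
have Vo A : open (V A) by exact: metric_ball_open.
pose G A := [set z | exists2 t, Rplus R t & V A (phi t z)].
have Go A : open (G A).
  rewrite openE => z [t t0 Vt].
  have : \forall w \near z, V A (phi t w).
    by apply: (time_map_continuous flow t0); apply: open_nbhs_nbhs.
  by apply: filterS => w Vw; exists t.
have Gd A : dense (G A).
  move=> O O0 oO; have V0 : V A !=set0 by exists (g A.1); rewrite /V/= dxx.
  by have [t t0 [z [Oz Vz]]] := trans _ _ oO (Vo A) O0 V0; exists z; split=> //; exists t.
have [||z zG] := polish_baire dist dtop dcomplete x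
  (G := fun n => oapp G setT (@unpickle (nat * nat)%type n)).
- by move=> n; case: unpickle => //=; exact: openT.
- by move=> n; case: unpickle => //= O O0 _; rewrite setIT.
exists z => O [w Ow] oO.
have [e e0 eO] := (dtop w O).1 (open_nbhs_nbhs (conj oO Ow)).
have h0 : 0 < e / 2 by lra.
have [k _ /(_ k (leqnn k)) /= kP] := near_infty_natSinv_lt (PosNum h0).
have k0 : 0 < k.+1%:R^-1 :> R by [].
have [|c [/= wc Dc]] := Ddense _ _ (metric_ball_open dist dtop w k.+1%:R^-1).
  by exists w; rewrite /= dxx.
have := zG (pickle (f c, k)); rewrite pickleK/= => -[t t0].
rewrite /V/= (gP _ c Dc erefl) => tc; exists (phi t z); split; last by exists t.
apply: eO => /=; have := dD w c (phi t z).
have := lt_trans wc kP; have := lt_trans tc kP; lra.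
Qed.

(** Suppose the interior is not empty, so that [x] reaches a periodic point [p].
    Then the orbit of [x] is compact, hence everything.  A periodic point reached
    by [x] is also reached after [p], by going around its own orbit
    often enough; so all periodic points lie on the orbit of [p], which is compact
    and therefore everything.  Such a semiflow is minimal. *)
Lemma devaney_orbit_interior (R : realType) (X : topologicalType)
    (hX : hausdorff_space X) (phi : R -> X -> X) (flow : semiflow phi)
    (x : X) (xdense : dense (semi_orbit phi x))
    (pdense : dense [set p | periodic_point phi p])
    (nmin : ~ minimal_semiflow phi) : interior (semi_orbit phi x) = set0.
Proof.
have [_ phiD phi0] := flow.
apply/seteqP; split => // w xw; apply: nmin.
have [|p [ip pper]] := pdense (interior (semi_orbit phi x)) _ (@open_interior _ _).
  by exists w.
have [a a0 xa] : semi_orbit phi x p by exact: interior_subset ip.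
rewrite /Rplus/= in a0.
have [tau tau0 ptau] := periodic_point_period pper.
have mul_period (c : X) (s : R) n : 0 <= s -> phi s c = c -> phi (n%:R * s) c = c.
  by move=> s0 cs; rewrite -(iter_time_map flow)//; exact: iter_fixed.
have dense_closed (A : set X) : closed A -> dense A -> A = [set: X].
  move=> cA dA; apply/seteqP; split=> // v _; apply: cA => U.
  rewrite nbhsE => -[V [oV Vv] VU].
  by have [|u [Vu Au]] := dA V _ oV; [exists v|exists u; split=> //; exact: VU].
have xT : semi_orbit phi x = [set: X].
  apply: dense_closed => //.
  rewrite (@eventually_periodic_orbit _ _ _ flow x a (tau + a)) //; last 2 first.
  - by lra.
  - by rewrite -phiD ?xa// /Rplus/= ltW.
  exact: orbit_arc_closed.
have pT : semi_orbit phi p = [set: X].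
  apply: dense_closed.
    rewrite (@eventually_periodic_orbit _ _ _ flow p 0 tau) ?phi0//.
    exact: orbit_arc_closed.
  move=> O O0 oO; have [c [Oc cper]] := pdense O O0 oO.
  exists c; split => //.
  have [s s0 cs] := periodic_point_period cper.
  have [b b0 xb] : semi_orbit phi x c by rewrite xT.
  rewrite /Rplus/= in b0.
  (* Going [n] times around the orbit of [c] takes longer than [a]. *)
  pose n := Num.bound (a / s).
  have na : a < n%:R * s.
    by rewrite -ltr_pdivrMr//; apply: archi_boundP; rewrite divr_ge0// ltW.
  exists (n%:R * s - a + b); first by rewrite /Rplus/=; lra.
  rewrite -xa phiD /Rplus/=; [|lra|lra].
  have -> : n%:R * s - a + b + a = n%:R * s + b by lra.
  rewrite -phiD /Rplus/=; [|lra|lra].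
  by rewrite xb mul_period// ltW.
move=> v; apply/seteqP; split=> // u _; apply: subset_closure.
have [b b0 pb] : semi_orbit phi p v by rewrite pT.
have [c c0 pc] : semi_orbit phi p u by rewrite pT.
rewrite /Rplus/= in b0 c0.
pose n := Num.bound (b / tau).
have nb : b < n%:R * tau.
  by rewrite -ltr_pdivrMr//; apply: archi_boundP; rewrite divr_ge0// ltW.
exists (c + (n%:R * tau - b)); first by rewrite /Rplus/=; lra.
rewrite -pb phiD /Rplus/=; [|lra|lra].
have -> : c + (n%:R * tau - b) + b = c + n%:R * tau by lra.
rewrite -phiD /Rplus/=; [|lra|lra].
by rewrite mul_period// ltW.
Qed.

Theorem proposition2p17 (R : realType) (X : topologicalType)
    (phi : R -> X -> X) (X_polish : polish_space R X) (flow_phi : semiflow phi) :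
  (topologically_transitive phi ->
   (exists x0 : X, dense (semi_orbit phi x0) /\
                   interior (semi_orbit phi x0) = set0) ->
   (exists p : X, periodic_point phi p) ->
   multidim_li_yorke_chaotic phi) /\
  (devaney_chaotic phi -> multidim_li_yorke_chaotic phi).
Proof.
split=> [_ [x [xdense xint]] [p pper]|[trans pdense nmin]].
  exact: dense_orbit_chaotic xdense xint p pper.
have [x _] : exists x : X, True.
  by apply: contrapT => X0; apply: nmin => x; case: X0; exists x.
have [x0 x0dense] := transitive_dense_orbit X_polish flow_phi x trans.
have [p [_ pper]] : [set: X] `&` [set p | periodic_point phi p] !=set0.
  by apply: pdense openT; exists x.
have hX : hausdorff_space X.
  by case: X_polish => _ [d [dist dtop _]]; exact: metric_hausdorff dist dtop.
apply: (dense_orbit_chaotic X_polish flow_phi x0dense _ pper).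
exact: devaney_orbit_interior.
Qed.
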